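(* Let $q$ be a prime power and $d\ge 2$ an integer. (a) If $(q,d)$ is one of the pairs $(2,2),(3,2),(2,3),(3,3),(4,3),(5,3),(2,4),(2,5),(2,6),(2,7)$, then every irreducible polynomial of degree $d$ in $\mathbb{F}_q[x]$ admits a visibly irreducible decomposition (VID) of degree $d$ over $\mathbb{F}_q$. (b) If $(q,d)=(3,5)$, then exactly half of all irreducible polynomials of degree $5$ in $\mathbb{F}_3[x]$ admit a VID of degree $5$ over $\mathbb{F}_3$. (c) For all other pairs $(q,d)$ (with $q$ a prime power and $d\ge 2$), no irreducible polynomial of degree $d$ in $\mathbb{F}_q[x]$ admits a VID of degree $d$ over $\mathbb{F}_q$.
   Context: $\mathbb{F}_q$ denotes the field with $q$ elements. A visibly irreducible decomposition (VID) of degree $d\ge 2$ over $\mathbb{F}_q$ is a sum $f_1(x)+f_2(x)+\cdots+f_r(x)=f(x)$ of $r\ge 2$ nonzero polynomials $f_i(x)\in\mathbb{F}_q[x]$ of degree at most $d$ such that: (VID-1) every irreducible polynomial $p(x)\in\mathbb{F}_q[x]$ of degree not exceeding $d/2$ divides all but exactly one of the $f_i(x)$; (VID-2) exactly one of the $f_i$ has degree $d$, the others having degree less than $d$. A polynomial $f$ admits a VID if it is equal to the sum $f_1+\cdots+f_r$ of some VID (for some $r\ge 2$). Irreducible polynomials have positive degree. In (b), the count may be taken up to scaling by $\mathbb{F}_3^\times$ (equivalently, among monic polynomials). *)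

(* Defs.v *)
From mathcomp Require Import all_boot all_order all_algebra.
Set Implicit Arguments.
Unset Strict Implicit.
Unset Printing Implicit Defensive.
Import GRing.Theory.
Local Open Scope ring_scope.

(* [f] is a visibly irreducible decomposition of degree [d].  Recall that
   [size p = (deg p).+1] for [p != 0], and that [irreducible_poly p] entails
   [1 < size p]; hence [vid_size] says "degree at most [d]", the bound in
   [vid_irr] says "deg p <= d / 2", and, given [vid_size], [vid_top] says that
   one [f i] has degree [d] while the others have degree less than [d]. *)
Record is_VID (F : finFieldType) (d r : nat) (f : 'I_r -> {poly F}) : Prop :=
  IsVID {
    vid_ge2 : (2 <= r)%N;
    vid_neq0 : forall i, f i != 0;
    vid_size : forall i, (size (f i) <= d.+1)%N;
    vid_irr : forall p : {poly F},
      irreducible_poly p -> (2 * (size p).-1 <= d)%N ->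
      exists! i, ~~ (p %| f i);
    vid_top : exists! i, size (f i) = d.+1
  }.

Definition admits_VID (F : finFieldType) (d : nat) (g : {poly F}) : Prop :=
  exists (r : nat) (f : 'I_r -> {poly F}),
    is_VID d f /\ g = \sum_(i < r) f i.

Definition irreducible_of_degree (F : finFieldType) (d : nat) (g : {poly F}) :
  Prop := irreducible_poly g /\ size g = d.+1.

Definition has_card (T : eqType) (P : T -> Prop) (n : nat) : Prop :=
  exists s : seq T, [/\ uniq s, forall x, x \in s <-> P x & size s = n].

Definition all_VID_pairs : seq (nat * nat) :=
  [:: (2, 2); (3, 2); (2, 3); (3, 3); (4, 3); (5, 3);
      (2, 4); (2, 5); (2, 6); (2, 7)]%N.

(* Main.v *)
Require Import Defs.
From mathcomp Require Import all_boot all_order all_algebra all_field.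

(* If f_1, ..., f_r is a VID and 2 m <= d, then every irreducible factor of the
   squarefree polynomial X^(q^m) - X divides f_i f_j for all i <> j, so that
   q^m <= deg f_i + deg f_j <= 2 d - 1.  With m = d/2 this rules out all other
   pairs but (2, 9), where the cubic polynomials have to be counted as well.

   Conversely, let S be a multiple of all irreducible polynomials of degree at
   most d/2.  An irreducible f of degree d has a two-term VID as soon as
   f = A a + B b with A B = S, deg (A a) = d, deg (B b) < d and B b <> 0: an
   irreducible p of small degree divides one of the two terms, and not both
   since it does not divide f.  Over a prime field the finitely many f are
   checked by computation; over F_4 two cases of interpolation suffice.  For
   (3, 5) the degree bound is attained, which forces r = 2 and f = a A + b B
   with constants a, b and A B = X^9 - X: this gives 48 of the 96 irreducible
   polynomials. *)

Set Implicit Arguments.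
Unset Strict Implicit.
Unset Printing Implicit Defensive.
Import GRing.Theory.
Local Open Scope ring_scope.

(** * Irreducible polynomials and X^(q^m) - X *)

Lemma expr_card_dvd (R : nzRingType) (q n m : nat) (x : R) :
  (n %| m)%N -> x ^+ (q ^ n) = x -> x ^+ (q ^ m) = x.
Proof.
move=> /dvdnP[k ->] xq; elim: k => [|k IHk]; first by rewrite expr1.
by rewrite mulSn expnD exprM xq.
Qed.

(** A root z of [p] lies in a field with q^(deg p) elements, so z is also a root of X^(q^m) - X; the
    two polynomials are not coprime, and [p] is irreducible. *)
Lemma irreducible_dvd_XqX (F : finFieldType) (p : {poly F}) (m : nat) :
  irreducible_poly p -> ((size p).-1 %| m)%N -> p %| 'X^(#|F| ^ m) - 'X.
Proof.
move=> p_irr pm; have [L dimL [z pz _]] := irredp_FAdjoin p_irr.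
have zm: z ^+ (#|F| ^ m) = z.
  apply: expr_card_dvd pm _; apply/eqP; rewrite -dimL.
  by have := Fermat's_little_theorem {:L} z; rewrite memvf => <-.
rewrite -[_ %| _]negbK -irreducible_poly_coprime //.
rewrite -(coprimep_map (in_alg L)); apply/negP=> /coprimep_root/(_ pz).
by rewrite rmorphB /= map_polyXn map_polyX !hornerE zm subrr eqxx.
Qed.

Lemma pnat_card_pchar (F : finFieldType) : [pchar F].-nat #|F|.
Proof.
have [p _ charFp] := finPcharP F; rewrite (eq_pnat _ (pcharf_eq charFp)).
have [n ->] : exists n, #|F| = (p ^ n)%N by eexists; apply: card_pprimeChar charFp.
by rewrite pnatX pnat_id ?(pcharf_prime charFp).
Qed.

Lemma size_XnX (R : nzRingType) (n : nat) :
  (1 < n)%N -> size ('X^n - 'X : {poly R}) = n.+1.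
Proof.
by move=> n_gt1; rewrite size_polyDl size_polyXn // size_polyN size_polyX ltnS.
Qed.

Lemma expn_card_gt1 (F : finFieldType) (m : nat) : (0 < m)%N -> (1 < #|F| ^ m)%N.
Proof. by move=> m_gt0; rewrite -(ltn_exp2l 0 m (finNzRing_gt1 F)) in m_gt0. Qed.

(** Raising to the power q^m is additive in this characteristic and fixes F, so its fixed points are
    stable under polynomial expressions with coefficients in F. *)
Lemma horner_in_alg_exp_card (F : finFieldType) (L : fieldExtType F) (m : nat)
    (z : L) (g : {poly F}) :
  z ^+ (#|F| ^ m) = z ->
  (map_poly (in_alg L) g).[z] ^+ (#|F| ^ m) = (map_poly (in_alg L) g).[z].
Proof.
move=> zq; have charL: [pchar L].-nat (#|F| ^ m)%N.
  by rewrite pnatX (eq_pnat _ (pchar_lalg L)) pnat_card_pchar.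
elim/poly_ind: g => [|g c IHg].
  by rewrite rmorph0 horner0 expr0n expn_eq0 eqn0Ngt (ltnW (finNzRing_gt1 F)).
rewrite rmorphD rmorphM /= map_polyX map_polyC !hornerE /=.
rewrite exprDn_pchar // exprMn IHg zq.
by rewrite exprZn expr1n (@expr_card_dvd _ _ 1 m) ?dvd1n ?expn1 ?expf_card.
Qed.

(** A root z of [p] is fixed by the power q^m, hence so is all of L = F(z). Thus X^(q^m) - X has
    q^(deg p) roots in L, at most its degree. *)
Lemma irreducible_dvd_XqX_leq (F : finFieldType) (p : {poly F}) (m : nat) :
  (0 < m)%N -> irreducible_poly p -> p %| 'X^(#|F| ^ m) - 'X -> ((size p).-1 <= m)%N.
Proof.
move=> m_gt0 p_irr; have [L dimL [z pz Lz]] := irredp_FAdjoin p_irr.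
move=> /dvdpP[h Sh].
have zq: z ^+ (#|F| ^ m) = z.
  have /(congr1 (fun g => (map_poly (in_alg L) g).[z])) := Sh.
  rewrite rmorphM rmorphB /= map_polyXn map_polyX !hornerE (rootP pz) mulr0.
  by move/eqP; rewrite subr_eq0 => /eqP.
have Lq (y : L) : y ^+ (#|F| ^ m) = y.
  have Ly: y \in <<1; z>>%VS by rewrite Lz memvf.
  rewrite -(Fadjoin_poly_eq Ly).
  by have /polyOver1P[g ->] := Fadjoin_polyOver 1 z y; apply: horner_in_alg_exp_card.
pose fL := FinFieldExtType L.
pose S : {poly fL} := 'X^(#|F| ^ m) - 'X.
have sS: size S = (#|F| ^ m).+1.
  by rewrite size_XnX ?expn_card_gt1.
have : (size (enum fL) < size S)%N.
  apply: max_poly_roots; rewrite ?enum_uniq -?size_poly_gt0 ?sS //.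
  apply/allP=> y _; rewrite rootE !hornerE subr_eq0; apply/eqP; exact: Lq.
have cardL : #|fL| = (#|F| ^ (size p).-1)%N.
  rewrite -dimL -[\dim _](_ : \dim {:finvect_type L} = _) // -card_vspace.
  by apply: eq_card => y; rewrite memvf.
by rewrite sS ltnS -cardE cardL leq_exp2l ?finNzRing_gt1.
Qed.

Lemma irreducible_factor (F : finFieldType) (g : {poly F}) :
  (1 < size g)%N -> exists2 p, irreducible_poly p & p %| g.
Proof.
have [n] := ubnP (size g); elim: n g => // n IHn g; rewrite ltnS => gn g_gt1.
have [/irreducibleP|] := boolP (irreducibleb g); first by exists g.
rewrite /irreducibleb g_gt1 negb_forall => /existsP[h].
rewrite negb_imply -ltnNge => /andP[hg h_gt1].
have [|p p_irr ph] := IHn h _ h_gt1.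
  by apply: leq_trans gn; rewrite -[X in (_ < X)%N](ltn_predK g_gt1) ltnS size_npoly.
by exists p => //; apply: dvdp_trans ph _; rewrite dvdpE.
Qed.

(** If the cofactor h of gcd(S, g) in S had an irreducible factor p, then p would divide both S and
    g, hence the gcd, and p^2 would divide the squarefree S. *)
Lemma separable_dvdp (F : finFieldType) (S g : {poly F}) :
  separable_poly S -> (forall p, irreducible_poly p -> p %| S -> p %| g) -> S %| g.
Proof.
move=> S_sep Sg; have S_neq0 := separable_poly_neq0 S_sep.
have [h Sh] := dvdpP _ _ (dvdp_gcdl S g).
have [h_gt1|h_le1] := ltnP 1 (size h).
  have [p p_irr ph] := irreducible_factor h_gt1.
  have pS : p %| S by rewrite Sh dvdp_mulr.
  have ppS : p * p %| S by rewrite Sh dvdp_mul // dvdp_gcd pS Sg.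
  have := (separable_polyP S_sep).1 _ _ ppS.
  rewrite coprimepp => /eqP p1; by have := p_irr.1; rewrite p1.
have h1 : h %| 1.
  rewrite dvdp1 eqn_leq h_le1 size_poly_gt0.
  by apply: contraNneq S_neq0 => h0; rewrite Sh h0 mul0r.
apply: dvdp_trans (dvdp_gcdr S g); rewrite {1}Sh.
by rewrite -[gcdp S g in X in _ %| X]mul1r dvdp_mul2r // gcdp_eq0 negb_and S_neq0.
Qed.

Lemma deriv_XqX (F : finFieldType) (m : nat) :
  (0 < m)%N -> ('X^(#|F| ^ m) - 'X : {poly F})^`() = -1.
Proof.
move=> m_gt0; rewrite derivB derivXn derivX.
have [p _ charFp] := finPcharP F.
have qF0 : (#|F| ^ m)%:R = 0 :> F.
  apply/eqP; rewrite -(dvdn_pcharf charFp).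
  have [n ->] : exists n, #|F| = (p ^ n.+1)%N.
    have [n Fpn] : exists n, #|F| = (p ^ n)%N by eexists; apply: card_pprimeChar charFp.
    by case: n Fpn => [F1|n ->]; [have := finNzRing_gt1 F; rewrite F1|exists n].
  by rewrite -expnM dvdn_exp ?muln_gt0.
by rewrite -scaler_nat qF0 scale0r sub0r.
Qed.

Lemma separable_XqX (F : finFieldType) (m : nat) :
  (0 < m)%N -> separable_poly ('X^(#|F| ^ m) - 'X : {poly F}).
Proof.
move=> m_gt0; rewrite unlock deriv_XqX // coprimep_sym.
by rewrite -scaleN1r coprimepZl ?oppr_eq0 ?oner_eq0 ?coprime1p.
Qed.

(** * Degree bounds for VIDs, and two-term VIDs *)

Lemma VID_other_part (F : finFieldType) (d r : nat) (f : 'I_r -> {poly F})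
    (i : 'I_r) :
  is_VID d f -> exists j, j != i.
Proof.
move=> /vid_ge2 r_ge2; have r_gt0 := ltnW r_ge2.
have [->|] := eqVneq i (Ordinal r_gt0); first by exists (Ordinal r_ge2).
by rewrite eq_sym; exists (Ordinal r_gt0).
Qed.

Lemma VID_size_other (F : finFieldType) (d r : nat) (f : 'I_r -> {poly F})
    (i j : 'I_r) :
  is_VID d f -> size (f i) = d.+1 -> j != i -> (size (f j) <= d)%N.
Proof.
move=> fV si ji; have := vid_size fV j; rewrite leq_eqVlt ltnS.
case/orP=> [/eqP sj|//]; have [k [_ k_uniq]] := vid_top fV.
by rewrite -(k_uniq i si) -(k_uniq j sj) eqxx in ji.
Qed.

Lemma VID_dvdM (F : finFieldType) (d r : nat) (f : 'I_r -> {poly F}) (i j : 'I_r)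
    (p : {poly F}) :
  is_VID d f -> i != j -> irreducible_poly p -> (2 * (size p).-1 <= d)%N ->
  p %| f i * f j.
Proof.
move=> fV ij p_irr pd; have [k [_ k_uniq]] := vid_irr fV p_irr pd.
have [|pi] := boolP (p %| f i); first exact: dvdp_mulr.
have [|pj] := boolP (p %| f j); first exact: dvdp_mull.
by rewrite -(k_uniq i pi) -(k_uniq j pj) eqxx in ij.
Qed.

Lemma VID_XqX_dvdM (F : finFieldType) (d r m : nat) (f : 'I_r -> {poly F})
    (i j : 'I_r) :
  is_VID d f -> i != j -> (0 < m)%N -> (2 * m <= d)%N ->
  'X^(#|F| ^ m) - 'X %| f i * f j.
Proof.
move=> fV ij m_gt0 md; apply: separable_dvdp (separable_XqX F m_gt0) _ => p p_irr pS.
apply: (VID_dvdM fV ij p_irr); apply: leq_trans md.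
by rewrite leq_mul2l irreducible_dvd_XqX_leq.
Qed.

(** Pairing the term of degree d with any other term gives a nonzero product of degree at most d +
    (d - 1). *)
Lemma VID_size_dvdM (F : finFieldType) (d r : nat) (f : 'I_r -> {poly F})
    (S : {poly F}) :
  is_VID d f -> (forall i j, i != j -> S %| f i * f j) -> (size S <= 2 * d)%N.
Proof.
move=> fV Sff; have [i0 [si0 _]] := vid_top fV.
have [j ji0] := VID_other_part i0 fV; have sj := VID_size_other fV si0 ji0.
apply: leq_trans (dvdp_leq _ (Sff _ _ ji0)) _; first by rewrite mulf_neq0 ?(vid_neq0 fV).
by rewrite size_mul ?(vid_neq0 fV) // si0 addnS /= mul2n -addnn leq_add2r.
Qed.

(** A small irreducible p cannot divide the irreducible u + v, whose degree d exceeds d/2; since it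
    divides u v, it divides exactly one of the two terms. *)
Lemma admits_VID2 (F : finFieldType) (d : nat) (u v : {poly F}) :
  (1 < d)%N -> irreducible_of_degree d (u + v) -> v != 0 -> (size v <= d)%N ->
  (forall p, irreducible_poly p -> (2 * (size p).-1 <= d)%N -> p %| u * v) ->
  admits_VID d (u + v).
Proof.
move=> d_gt1 [uv_irr suv] v_neq0 sv uvP.
have su : size u = d.+1.
  by rewrite -[u](addrK v) size_polyDl // size_polyN suv ltnS.
have u_neq0 : u != 0 by rewrite -size_poly_gt0 su.
exists 2, (fun i : 'I_2 => if i == ord0 then u else v); split; last first.
  by rewrite big_ord_recl big_ord1.
split=> //.
- by move=> i; case: ifP.
- by move=> i; case: ifP; rewrite ?su // leqW.
- move=> p p_irr pd; have puvM := uvP p p_irr pd.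
  have pN1 : size p != 1 by rewrite neq_ltn p_irr.1 orbT.
  have puv : ~~ (p %| u + v).
    apply: contraTN pd => /(uv_irr.2 _ pN1)/eqp_size ->.
    by rewrite suv -ltnNge /= ltn_Pmull // ltnW.
  have [pu|pu] := boolP (p %| u).
    have pv : ~~ (p %| v) by rewrite -(dvdp_addr v pu).
    exists (lift ord0 ord0); split=> //= i; rewrite -[i == ord0]negbK.
    by case: (unliftP ord0 i) => [j ->|->]; rewrite ?pu // => _; rewrite [j]ord1.
  exists ord0; split=> //= i; rewrite -[i == ord0]negbK.
  case: (unliftP ord0 i) => [j ->|->] //; rewrite [j]ord1 /= => pvN.
  by move: puvM; rewrite mulrC Gauss_dvdpr ?irreducible_poly_coprime // (negPf pu).
exists ord0; split=> //= i; case: (unliftP ord0 i) => [j ->|->] //=.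
by move=> sv1; rewrite sv1 ltnn in sv.
Qed.

(** * Computing with coefficient lists over a prime field *)

(* Coefficient lists, constant term first; the entries are only meaningful
   modulo [p], so sums and products are computed without reduction. *)
Fixpoint padd (s t : seq nat) : seq nat :=
  if s is a :: s' then if t is b :: t' then (a + b)%N :: padd s' t' else s else t.

Fixpoint pmul (s t : seq nat) : seq nat :=
  if s is a :: s' then padd [seq (a * b)%N | b <- t] (0%N :: pmul s' t) else [::].

(** Lists of different lengths may represent the same polynomial: the surplus entries only have to
    vanish modulo p. *)
Fixpoint peq (p : nat) (s t : seq nat) : bool :=
  match s, t with
  | a :: s', b :: t' => if a == b %[mod p] then peq p s' t' else false
  | [::], _ => all (dvdn p) t
  | _, [::] => all (dvdn p) s
  end.

Fixpoint codes (p n : nat) : seq (seq nat) :=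
  if n is n'.+1 then [seq a :: s | a <- iota 0 p, s <- codes p n'] else [:: [::]].

Definition lead_codes (l : seq nat) (p n : nat) : seq (seq nat) :=
  [seq rcons s c | c <- l, s <- codes p n].

Definition monic_codes : nat -> nat -> seq (seq nat) := lead_codes [:: 1%N].

Definition deg_codes (p : nat) : nat -> seq (seq nat) := lead_codes (iota 1 p.-1) p.

(** In a proper factorization one factor has degree at most d/2, and it can be made monic by moving
    a constant to the other factor. *)
Definition reducibles (p d : nat) : seq (seq nat) :=
  flatten [seq [seq pmul g h | g <- monic_codes p k, h <- deg_codes p (d - k)]
          | k <- iota 1 d./2].

Definition splits (p : nat) (S : seq nat) (k : nat) : seq (seq nat * seq nat) :=
  [seq AB <- [seq (A, B) | A <- monic_codes p k, B <- monic_codes p ((size S).-1 - k)]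
  | peq p (pmul AB.1 AB.2) S].

(* The pairs (A a, B b) with A B = S; k is the degree of A. *)
Definition decomps (p : nat) (S : seq nat) (d : nat) : seq (seq nat * seq nat) :=
  [seq uv <- flatten
      [seq [seq (pmul AB.1 a, pmul AB.2 b) | a <- deg_codes p (d - k),
                                             b <- codes p (d + k - (size S).-1)]
      | k <- iota (size S - d) (2 * d - (size S).-1), AB <- splits p S k]
  | ~~ peq p uv.2 [::] && (size uv.2 <= d)%N].

(** The nested [if] avoids searching [R] under call-by-value evaluation when a decomposition has
    been found. *)
Definition check (p : nat) (S : seq nat) (d : nat) : bool :=
  let D := [seq padd uv.1 uv.2 | uv <- decomps p S d] in
  let R := reducibles p d in
  all (fun f => if has (peq p f) D then true else has (peq p f) R) (deg_codes p d).

Definition XnX (p n : nat) : seq nat := [:: 0, p.-1 & ncons (n - 2) 0 [:: 1]]%N.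

(** * Correctness of the list computations *)

Definition Pol (F : finFieldType) (s : seq nat) : {poly F} := Poly [seq n%:R | n <- s].

Lemma Pol_cons (F : finFieldType) (a : nat) (s : seq nat) :
  Pol F (a :: s) = Pol F s * 'X + a%:R%:P.
Proof. by rewrite /Pol /= cons_poly_def. Qed.

Lemma Pol_padd (F : finFieldType) (s t : seq nat) :
  Pol F (padd s t) = Pol F s + Pol F t.
Proof.
elim: s t => [|a s IHs] [|b t] /=; rewrite ?add0r ?addr0 //.
by rewrite !Pol_cons IHs natrD polyCD mulrDl addrACA.
Qed.

Lemma Pol_scale (F : finFieldType) (a : nat) (s : seq nat) :
  Pol F [seq (a * b)%N | b <- s] = a%:R *: Pol F s.
Proof.
elim: s => [|b s IHs] /=; first by rewrite scaler0.
by rewrite !Pol_cons IHs scalerDr natrM polyCM scalerAl -!mul_polyC.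
Qed.

Lemma Pol_pmul (F : finFieldType) (s t : seq nat) :
  Pol F (pmul s t) = Pol F s * Pol F t.
Proof.
elim: s => [|a s IHs] /=; first by rewrite mul0r.
by rewrite Pol_padd Pol_scale !Pol_cons IHs addr0 mulrDl mul_polyC mulrAC addrC.
Qed.

Lemma eqr_nat_pchar (R : nzRingType) (p m n : nat) :
  p \in [pchar R] -> (m%:R == n%:R :> R) = (m == n %[mod p]).
Proof.
move=> charRp; wlog le_nm : m n / (n <= m)%N => [IH|].
  by have [/IH //|/ltnW/IH] := leqP n m; rewrite eq_sym => ->; rewrite eq_sym.
by rewrite eqn_mod_dvd // -subr_eq0 -natrB // (dvdn_pcharf charRp).
Qed.

Lemma poly_cons_eq (R : nzRingType) (g h : {poly R}) (a b : R) :
  (g * 'X + a%:P == h * 'X + b%:P) = (a == b) && (g == h).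
Proof.
apply/eqP/andP=> [gh|[/eqP-> /eqP->] //].
split; apply/eqP.
  by have := congr1 (fun h : {poly R} => h`_0) gh; rewrite !coefD !coefMX !coefC /= !add0r.
apply/polyP=> i; have := congr1 (fun h : {poly R} => h`_i.+1) gh.
by rewrite !coefD !coefMX !coefC /= !addr0.
Qed.

Lemma peqP (F : finFieldType) (p : nat) (s t : seq nat) :
  p \in [pchar F] -> peq p s t = (Pol F s == Pol F t).
Proof.
move=> charFp; have zeroP u : all (dvdn p) u = (0 == Pol F u).
  elim: u => [|a u IHu] /=; first by rewrite /Pol /= eqxx.
  rewrite Pol_cons -[0](mul0r 'X) -[_ * 'X]addr0 poly_cons_eq -IHu.
  by rewrite (dvdn_pcharf charFp) [0 == _]eq_sym.
elim: s t => [|a s IHs] [|b t].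
- exact: zeroP.
- exact: zeroP.
- by rewrite [RHS]eq_sym -zeroP.
- by rewrite /= !Pol_cons poly_cons_eq (eqr_nat_pchar _ _ charFp) IHs.
Qed.

Lemma pchar_card_prime (F : finFieldType) (p : nat) :
  prime p -> #|F| = p -> p \in [pchar F].
Proof. by move=> p_pr cardF; apply: (@card_finPcharP F p 1). Qed.

Lemma natr_surj (F : finFieldType) (p : nat) (x : F) :
  prime p -> #|F| = p -> exists2 m, m \in iota 0 p & x = m%:R.
Proof.
move=> p_pr cardF; pose e (m : 'I_p) : F := (m : nat)%:R.
have e_inj : injective e.
  move=> m n /eqP; rewrite (eqr_nat_pchar _ _ (pchar_card_prime p_pr cardF)).
  by rewrite !modn_small // => /eqP/val_inj.
have /(_ x) : forall y, y \in codom e by apply: inj_card_onto e_inj _; rewrite card_ord cardF.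
by case/codomP=> m ->; exists (val m) => //; rewrite mem_iota ltn_ord.
Qed.

Lemma codes_surj (F : finFieldType) (p : nat) (s : seq F) :
  prime p -> #|F| = p -> exists2 t, t \in codes p (size s) & [seq n%:R | n <- t] = s.
Proof.
move=> p_pr cardF; elim: s => [|x s [t ts st]]; first by exists [::].
have [m mp xm] := natr_surj x p_pr cardF; exists (m :: t); last by rewrite /= xm st.
by apply/allpairsP; exists (m, t).
Qed.

Lemma Pol_rcons (F : finFieldType) (s : seq nat) (g : {poly F}) (c : nat) :
  [seq n%:R | n <- s] = mkseq (nth 0 g) (size g).-1 -> lead_coef g = c%:R ->
  g != 0 -> Pol F (rcons s c) = g.
Proof.
move=> sg gc g_neq0; rewrite /Pol map_rcons sg -gc /lead_coef -mkseqS.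
rewrite prednK ?size_poly_gt0 //; apply/polyP=> i; rewrite coef_Poly.
have [ig|ig] := ltnP i (size g); first by rewrite nth_mkseq.
by rewrite !nth_default ?size_mkseq.
Qed.

Lemma lead_codes_surj (F : finFieldType) (p n c : nat) (l : seq nat) (g : {poly F}) :
  prime p -> #|F| = p -> size g = n.+1 -> c \in l -> lead_coef g = c%:R ->
  exists2 t, t \in lead_codes l p n & Pol F t = g.
Proof.
move=> p_pr cardF sg cl gc.
have [t] := codes_surj (mkseq (nth 0 g) n) p_pr cardF; rewrite size_mkseq => tn tg.
exists (rcons t c); first exact: allpairs_f.
by apply: Pol_rcons; rewrite ?sg // -size_poly_gt0 sg.
Qed.

Lemma monic_codes_surj (F : finFieldType) (p n : nat) (g : {poly F}) :
  prime p -> #|F| = p -> size g = n.+1 -> g \is monic ->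
  exists2 t, t \in monic_codes p n & Pol F t = g.
Proof.
by move=> p_pr cardF sg /monicP g1; apply: (lead_codes_surj (c := 1)) sg _ g1.
Qed.

Lemma deg_codes_surj (F : finFieldType) (p n : nat) (g : {poly F}) :
  prime p -> #|F| = p -> size g = n.+1 ->
  exists2 t, t \in deg_codes p n & Pol F t = g.
Proof.
move=> p_pr cardF sg; have [c cp gc] := natr_surj (lead_coef g) p_pr cardF.
apply: (lead_codes_surj p_pr cardF sg _ gc); move: cp.
rewrite !mem_iota add1n prednK ?(prime_gt0 p_pr) // => /= ->; rewrite andbT lt0n.
by apply/eqP=> c0; have := size_poly_gt0 g; rewrite sg -lead_coef_eq0 gc c0 eqxx.
Qed.

Lemma size_Pol_rcons (F : finFieldType) (p c : nat) (s : seq nat) :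
  p \in [pchar F] -> ~~ (p %| c)%N -> size (Pol F (rcons s c)) = (size s).+1.
Proof.
move=> charFp; rewrite (dvdn_pcharf charFp) => c_neq0.
by rewrite /Pol (PolyK (c := 0)) ?size_map ?size_rcons // map_rcons last_rcons.
Qed.

Lemma size_codes (p n : nat) (s : seq nat) : s \in codes p n -> size s = n.
Proof.
by elim: n s => [|n IHn] s /=; [rewrite inE => /eqP->|case/allpairsP=> [[a t] [_ /IHn <- ->]]].
Qed.

Lemma size_Pol_deg_codes (F : finFieldType) (p n : nat) (s : seq nat) :
  prime p -> #|F| = p -> s \in deg_codes p n -> size (Pol F s) = n.+1.
Proof.
move=> p_pr cardF; case/allpairsP=> [[c t] /= [cp /size_codes tn ->]].
rewrite (@size_Pol_rcons _ p) ?tn ?pchar_card_prime //.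
move: cp; rewrite mem_iota add1n prednK ?(prime_gt0 p_pr) // => /andP[c_gt0 cp].
by rewrite gtnNdvd.
Qed.

Lemma size_Pol_monic_codes (F : finFieldType) (p n : nat) (s : seq nat) :
  prime p -> #|F| = p -> s \in monic_codes p n -> size (Pol F s) = n.+1.
Proof.
move=> p_pr cardF; case/allpairsP=> [[c t] /= [cp /size_codes tn ->]].
rewrite (@size_Pol_rcons _ p) ?tn ?pchar_card_prime //.
by move: cp; rewrite inE => /eqP ->; rewrite gtnNdvd ?prime_gt1.
Qed.

Lemma reduciblesP (F : finFieldType) (p d : nat) (f : seq nat) :
  prime p -> #|F| = p -> (0 < d)%N -> size (Pol F f) = d.+1 ->
  reflect (irreducible_poly (Pol F f)) (~~ has (peq p f) (reducibles p d)).
Proof.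
move=> p_pr cardF d_gt0 sf; have charFp := pchar_card_prime p_pr cardF.
apply: (iffP idP) => [f_red|f_irr]; last first.
  apply/hasPn=> gh /flatten_mapP[k]; rewrite mem_iota => /andP[k_gt0 kd].
  case/allpairsP=> [[g h] /= [gk hk ->]]; rewrite (peqP _ _ charFp) Pol_pmul.
  have sg := size_Pol_monic_codes p_pr cardF gk.
  apply: contraTneq kd => fgh.
  have := f_irr.2 (Pol F g); rewrite sg fgh dvdp_mulr // => /(_ _ isT).
  case: k {gk hk} k_gt0 sg => // k _ sg /(_ isT)/eqp_size.
  rewrite -fgh sg sf => -[->]; rewrite -ltnNge.
  by rewrite add1n ltnS -divn2 ltn_Pdiv.
(* Dividing g by its leading coefficient and multiplying h by it would put a product with 1 <= deg g
   <= d/2 in the list. *)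
have factor_big (g h : {poly F}) :
    Pol F f = g * h -> (1 < size g)%N -> (d./2 < (size g).-1)%N.
  move=> fgh g_gt1; rewrite ltnNge; apply: contraNN f_red => gd.
  have [g_neq0 h_neq0] : g != 0 /\ h != 0.
    by apply/andP; rewrite -negb_or -mulf_eq0 -fgh -size_poly_eq0 sf.
  have gE : size g = (size g).-1.+1 by rewrite (ltn_predK g_gt1).
  have lg_neq0 : lead_coef g != 0 by rewrite lead_coef_eq0.
  have lgV_neq0 : (lead_coef g)^-1 != 0 by rewrite invr_eq0.
  have [||t tk tg] := monic_codes_surj (g := (lead_coef g)^-1 *: g) (n := (size g).-1) p_pr cardF.
  - by rewrite size_scale.
  - by rewrite monicE lead_coefZ mulVf.
  have [|s sk sh] := deg_codes_surj (g := lead_coef g *: h) (n := d - (size g).-1) p_pr cardF.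
    rewrite size_scale // -subSn; last by rewrite (leq_trans gd) // -divn2 leq_div.
    by rewrite -sf fgh size_mul // gE /= addKn.
  apply/hasP; exists (pmul t s); last first.
    rewrite (peqP _ _ charFp) Pol_pmul tg sh -scalerAl -scalerAr scalerA mulVf //.
    by rewrite scale1r fgh.
  apply/flatten_mapP; exists (size g).-1; last exact: allpairs_f.
  by rewrite mem_iota add1n ltnS gd -ltnS -gE g_gt1.
split; first by rewrite sf ltnS.
move=> q q_neq1 qf; have q_neq0 : q != 0.
  by apply: contraTneq qf => ->; rewrite dvd0p -size_poly_eq0 sf.
have [h fE] := dvdpP _ _ qf.
have h_neq0 : h != 0 by apply: contra_eq_neq sf => h0; rewrite fE h0 mul0r size_poly0.
have q_gt1 : (1 < size q)%N by rewrite ltn_neqAle eq_sym q_neq1 size_poly_gt0.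
have [h_gt1|h_le1] := ltnP 1 (size h); last first.
  rewrite fE -{1}[q]mul1r eqp_mul2r // eqp_sym -size_poly_eq1.
  by rewrite eqn_leq h_le1 size_poly_gt0.
(* Two nonconstant factors would both have degree above d/2, while their degrees add up to d. *)
have := leq_add (factor_big _ _ fE h_gt1) (factor_big _ _ (etrans fE (mulrC _ _)) q_gt1).
have : ((size h).-1 + (size q).-1 = d)%N.
  apply/eqP; rewrite -eqSS -sf fE size_mul // -{2}(ltn_predK h_gt1) -{2}(ltn_predK q_gt1).
  by rewrite addnS addSn.
move=> ->; rewrite addSn addnS addnn -[leqRHS]odd_double_half -addn2 addnC leq_add2r.
by case: odd.
Qed.

Lemma decompsP (F : finFieldType) (p d : nat) (S : seq nat) (uv : seq nat * seq nat) :
  prime p -> #|F| = p -> uv \in decomps p S d ->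
  [/\ Pol F S %| Pol F uv.1 * Pol F uv.2, Pol F uv.2 != 0 & (size (Pol F uv.2) <= d)%N].
Proof.
move=> p_pr cardF; have charFp := pchar_card_prime p_pr cardF.
rewrite mem_filter => /andP[/andP[v_neq0 vd]].
case/flattenP=> _ /allpairsPdep[k [[A B] [_ + ->]]].
rewrite mem_filter (peqP _ _ charFp) Pol_pmul => /andP[/eqP/= <- _].
case/allpairsPdep=> [a [b [_ _ uvE]]].
split; first by rewrite uvE /= !Pol_pmul mulrACA dvdp_mulr.
  by rewrite (peqP _ _ charFp) in v_neq0.
by apply: leq_trans (size_Poly _) _; rewrite size_map.
Qed.

Lemma Pol_XnX (F : finFieldType) (p n : nat) :
  prime p -> #|F| = p -> (1 < n)%N -> Pol F (XnX p n) = 'X^n - 'X.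
Proof.
move=> p_pr cardF; have charFp := pchar_card_prime p_pr cardF.
case: n => [|[|n]] // _; rewrite /XnX subn2 !Pol_cons /=.
have -> : Pol F (ncons n 0%N [:: 1%N]) = 'X^n.
  elim: n => [|n IHn] /=; first by rewrite /Pol /= cons_poly_def mul0r add0r.
  by rewrite Pol_cons IHn addr0 exprSr.
rewrite -subn1 natrB ?prime_gt0 // (pcharf0 charFp) sub0r.
by rewrite addr0 polyCN polyC1 mulrBl mul1r -!exprSr.
Qed.

(** * From a successful check to VIDs *)

Lemma check_admits_VID (F : finFieldType) (p d : nat) (S : seq nat) (g : {poly F}) :
  prime p -> #|F| = p -> (1 < d)%N -> check p S d ->
  (forall h : {poly F}, irreducible_poly h -> (2 * (size h).-1 <= d)%N -> h %| Pol F S) ->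
  irreducible_of_degree d g -> admits_VID d g.
Proof.
move=> p_pr cardF d_gt1 /allP chk S_dvd g_irr; have charFp := pchar_card_prime p_pr cardF.
have [f fd fg] := deg_codes_surj p_pr cardF g_irr.2.
have := chk f fd; case: ifP => [/hasP[_ /mapP[uv uvD ->]]|_ /negPn/negP f_red].
  rewrite (peqP _ _ charFp) Pol_padd fg => /eqP gE.
  have [uvS v_neq0 vd] := decompsP p_pr cardF uvD.
  rewrite gE in g_irr * => _; apply: (admits_VID2 d_gt1 g_irr v_neq0 vd) => h h_irr hd.
  exact: dvdp_trans (S_dvd h h_irr hd) uvS.
case: f_red; apply/(reduciblesP p_pr cardF (d := d)); rewrite ?fg ?(ltnW d_gt1) //.
  exact: g_irr.2.
exact: g_irr.1.
Qed.

Lemma leq_double_half (n d : nat) : (2 * n <= d)%N = (n <= d./2)%N.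
Proof. by rewrite geq_half_double mul2n. Qed.

Lemma small_dvdp_XqX (F : finFieldType) (d m : nat) (h : {poly F}) :
  irreducible_poly h -> (2 * (size h).-1 <= d)%N ->
  all (fun n => n %| m)%N (iota 1 d./2) -> h %| 'X^(#|F| ^ m) - 'X.
Proof.
move=> h_irr hd /allP dm; apply: irreducible_dvd_XqX => //; apply: dm.
by rewrite mem_iota add1n ltnS -leq_double_half hd andbT -ltnS (ltn_predK h_irr.1) h_irr.1.
Qed.

Lemma check_XqX_admits_VID (F : finFieldType) (d m : nat) (g : {poly F}) :
  prime #|F| -> (1 < d)%N -> (0 < m)%N -> check #|F| (XnX #|F| (#|F| ^ m)) d ->
  all (fun n => n %| m)%N (iota 1 d./2) ->
  irreducible_of_degree d g -> admits_VID d g.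
Proof.
move=> F_pr d_gt1 m_gt0 chk dm; apply: check_admits_VID chk _ => // h h_irr hd.
by rewrite Pol_XnX ?expn_card_gt1 //; apply: small_dvdp_XqX dm.
Qed.

(* (X^8 - X)(X^2 + X + 1) is the product of the irreducible polynomials of
   degree at most 3 over F_2. *)
Lemma check_F2_admits_VID (F : finFieldType) (d : nat) (g : {poly F}) :
  #|F| = 2%N -> d./2 = 3%N -> check 2 (pmul (XnX 2 8) [:: 1; 1; 1]%N) d ->
  irreducible_of_degree d g -> admits_VID d g.
Proof.
move=> F2 d3 chk; apply: check_admits_VID chk _ => //; first by case: d d3 => [|[]].
move=> h h_irr; rewrite leq_double_half d3 => hd.
have XqX m : ((size h).-1 %| m)%N -> h %| 'X^(2 ^ m) - 'X.
  by rewrite -F2; apply: irreducible_dvd_XqX.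
have XqXE m : (0 < m)%N -> Pol F (XnX 2 (2 ^ m)) = 'X^(2 ^ m) - 'X.
  by move=> m_gt0; rewrite Pol_XnX //; have := expn_card_gt1 F m_gt0; rewrite F2.
rewrite Pol_pmul (XqXE 3) //.
have [h3|h3] := boolP ((size h).-1 %| 3)%N; first by rewrite dvdp_mulr ?XqX.
have h2 : (size h).-1 = 2%N.
  by have := h_irr.1; case: (size h) h3 hd => [|[|[|[|[|]]]]].
(* The remaining quadratic h divides X^4 - X = (X^2 - X)(X^2 + X + 1) but not X^2 - X, whose
   irreducible factors are linear. *)
rewrite dvdp_mull //; have : h %| 'X^(2 ^ 2) - 'X by rewrite XqX ?h2.
rewrite -XqXE //; have /eqP-> : Pol F (XnX 2 4) == Pol F (pmul (XnX 2 2) [:: 1; 1; 1]%N).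
  by rewrite -(peqP _ _ (pchar_card_prime _ F2)).
rewrite Pol_pmul Gauss_dvdpr // irreducible_poly_coprime //.
rewrite (XqXE 1) //; apply/negP; rewrite -F2 => /(irreducible_dvd_XqX_leq (ltn0Sn 0) h_irr).
by rewrite h2.
Qed.

(** * The pairs without decompositions *)

Lemma VID_expn_card_ltn (F : finFieldType) (d m : nat) (g : {poly F}) :
  admits_VID d g -> (0 < m)%N -> (2 * m <= d)%N -> (#|F| ^ m < 2 * d)%N.
Proof.
case=> [r [f [fV _]]] m_gt0 md; rewrite -(size_XnX F (expn_card_gt1 F m_gt0)).
by apply: (VID_size_dvdM fV) => i j ij; apply: (VID_XqX_dvdM fV ij).
Qed.

(* Here X^16 - X only gives 17 <= 2 d in [VID_size_dvdM], so the factor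
   1 + X + ... + X^6 of X^8 - X, which contains the cubics, is used too. *)
Lemma VID_F2_degree9 (F : finFieldType) (g : {poly F}) :
  #|F| = 2%N -> ~ admits_VID 9 g.
Proof.
move=> F2 [r [f [fV _]]]; have charF2 := pchar_card_prime (isT : prime 2) F2.
have XqXE m : (0 < m)%N -> Pol F (XnX 2 (2 ^ m)) = 'X^(#|F| ^ m) - 'X.
  by move=> m_gt0; rewrite F2 Pol_XnX //; have := expn_card_gt1 F m_gt0; rewrite F2.
pose h := nseq 7 1%N; pose b := [:: 1; 0; 1; 0; 1]%N.
pose w := pmul [:: 0; 0; 1; 0; 1]%N h.
(* With Y = X^2 - X: h = 1 + b Y and X^16 - X = Y + w h. *)
have h_S16 : coprimep (Pol F h) ('X^(#|F| ^ 4) - 'X).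
  rewrite -XqXE //; apply/Bezout_coprimepP.
  (* In characteristic 2, (1 + b w) h + b (Y + w h) = h + b Y = 1. *)
  exists (Pol F (padd [:: 1%N] (pmul b w)), Pol F b).
  have : Pol F (padd (pmul (padd [:: 1%N] (pmul b w)) h) (pmul b (XnX 2 16)))
      == Pol F [:: 1%N] by rewrite -(peqP _ _ charF2).
  rewrite Pol_padd [in X in X + _]Pol_pmul [in X in _ + X]Pol_pmul => /eqP /= ->.
  by rewrite /Pol /= cons_poly_def mul0r add0r eqpxx.
have h_S8 : Pol F h %| 'X^(#|F| ^ 3) - 'X.
  rewrite -XqXE //.
  have /eqP-> : Pol F (XnX 2 8) == Pol F (pmul [:: 0; 1; 1]%N h) by rewrite -(peqP _ _ charF2).
  by rewrite Pol_pmul dvdp_mull.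
have sh : size (Pol F h) = 7%N by apply: (@size_Pol_rcons _ 2 1 (nseq 6 1%N)).
have : (size (Pol F h * ('X^(#|F| ^ 4) - 'X))%R <= 2 * 9)%N.
  apply: (VID_size_dvdM fV) => i j ij; rewrite Gauss_dvdp // (VID_XqX_dvdM fV ij) // andbT.
  by apply: dvdp_trans h_S8 _; apply: (VID_XqX_dvdM fV ij).
by rewrite size_mul -?size_poly_gt0 ?sh ?size_XnX ?F2.
Qed.

(** For m = d/2 rounded down, 2 d <= 4 m + 2; so for d >= 10 already 2^m reaches the bound 2 d. *)
Lemma expn2_gt4 (m : nat) : (4 < m)%N -> (4 * m + 2 <= 2 ^ m)%N.
Proof.
elim: m => // m IHm; rewrite ltnS leq_eqVlt => /orP[/eqP<- //|m_gt4].
rewrite expnS mul2n -addnn mulnS [(4 + _)%N]addnC addnAC leq_add ?IHm //.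
by apply: leq_trans (IHm m_gt4); rewrite (leq_trans _ (leq_addr _ _)) // leq_pmulr // (leq_trans _ m_gt4).
Qed.

Lemma not_admits_VID (F : finFieldType) (d : nat) (g : {poly F}) :
  (2 <= d)%N -> (#|F|, d) \notin all_VID_pairs -> (#|F|, d) <> (3, 5)%N ->
  ~ admits_VID d g.
Proof.
move=> d_ge2 qd qd35 gV; have q_gt1 : (1 < #|F|)%N := finNzRing_gt1 F.
(* Any k with 2 d <= k^m bounds q, because q^m < 2 d. *)
have q_lt k m : (0 < m)%N -> (2 * m <= d)%N -> (2 * d <= k ^ m)%N -> (#|F| < k)%N.
  move=> m_gt0 md dk; rewrite ltnNge -(leq_exp2r _ _ m_gt0) -ltnNge.
  exact: leq_trans (VID_expn_card_ltn gV m_gt0 md) dk.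
have [d_ge10|] := leqP 10 d.
  have h_ge5 : (4 < d./2)%N by have := half_leq d_ge10.
  suff : (#|F| < 2)%N by rewrite ltnNge q_gt1.
  apply: (q_lt 2 d./2); first exact: (leq_trans _ h_ge5).
    by rewrite leq_double_half.
  apply: leq_trans (expn2_gt4 h_ge5).
  rewrite -{1}(odd_double_half d) mulnDr -mul2n mulnA addnC leq_add2l.
  by case: odd.
have F2 := @VID_F2_degree9 F g; move: d_ge2 gV q_lt qd qd35 q_gt1 F2.
case: d => [|[|[|[|[|[|[|[|[|[|d]]]]]]]]]] // _ gV q_lt qd qd35 q_gt1 F2 _.
(* For each d from 2 to 9, with m = d/2 rounded down, k is the least integer with 2 d <= k^m. What
   survives is excluded by hypothesis, except (2, 9). *)
- by have := q_lt 4 1 isT isT isT; case: #|F| qd q_gt1 => [|[|[|[|]]]].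
- by have := q_lt 6 1 isT isT isT; case: #|F| qd q_gt1 => [|[|[|[|[|[|]]]]]].
- by have := q_lt 3 2 isT isT isT; case: #|F| qd q_gt1 => [|[|[|]]].
- by have := q_lt 4 2 isT isT isT; case: #|F| qd qd35 q_gt1 => [|[|[|[|]]]].
- by have := q_lt 3 3 isT isT isT; case: #|F| qd q_gt1 => [|[|[|]]].
- by have := q_lt 3 3 isT isT isT; case: #|F| qd q_gt1 => [|[|[|]]].
- by have := q_lt 2 4 isT isT isT; rewrite ltnNge q_gt1.
- have := q_lt 3 4 isT isT isT; case: #|F| F2 q_gt1 => [|[|[|]]] // F2 _ _.
  exact: F2.
Qed.

(** * Cubics over the field with four elements *)

Lemma irreducible_noroot (F : finFieldType) (d : nat) (f : {poly F}) (a : F) :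
  (1 < d)%N -> irreducible_of_degree d f -> f.[a] != 0.
Proof.
move=> d_gt1 [f_irr sf]; apply/negP=> fa.
have /(f_irr.2 _) : size ('X - a%:P) != 1 by rewrite size_XsubC.
by rewrite dvdp_XsubCl => /(_ fa)/eqp_size; rewrite size_XsubC sf => -[d1]; rewrite -d1 in d_gt1.
Qed.

(* Both sides are the value at b of the derivative of X^q - X. *)
Lemma horner_prod_XsubC_neq (F : finFieldType) (b : F) :
  (\prod_(x | x != b) ('X - x%:P)).[b] = -1.
Proof.
have /(congr1 (fun g => g^`().[b])) := finField_genPoly F.
rewrite (bigD1 b) //= derivM derivXsubC mul1r hornerD hornerM !hornerE subrr mul0r addr0 => <-.
have := deriv_XqX F (isT : 0 < 1)%N; rewrite expn1 => ->.
by rewrite hornerN hornerC.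
Qed.

Lemma admits_VID_F4 (F : finFieldType) (f : {poly F}) :
  #|F| = 4%N -> irreducible_of_degree 3 f -> admits_VID 3 f.
Proof.
move=> F4 f_irr; have f_root a := irreducible_noroot a (isT : 1 < 3)%N f_irr.
have sf := f_irr.2; have f_neq0 : f != 0 by rewrite -size_poly_gt0 sf.
have size_S : size ('X^#|F| - 'X : {poly F}) = 5%N by rewrite size_XnX F4.
set c := lead_coef f; have c_neq0 : c != 0 by rewrite lead_coef_eq0.
have split2 (u v : {poly F}) : f = u + v -> v != 0 -> (size v <= 3)%N ->
    'X^#|F| - 'X %| u * v -> admits_VID 3 f.
  move=> fE v_neq0 sv Suv; rewrite fE; apply: admits_VID2 => //; first by rewrite -fE.
  move=> h h_irr hd; apply: dvdp_trans Suv.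
  by have := small_dvdp_XqX (m := 1) h_irr hd isT; rewrite expn1.
(* If f(b) = -c, take A to be the product of all X - x with x != b. Then A(b) = -1, so f - c A
   vanishes at b, and its cubic terms cancel. *)
have [/existsP[b /eqP fb]|] := boolP [exists b, f.[b] == - c].
  pose A := \prod_(x | x != b) ('X - x%:P).
  have S_bA : 'X^#|F| - 'X = ('X - b%:P) * A by rewrite finField_genPoly (bigD1 b).
  have A_monic : A \is monic by apply: monic_prod_XsubC.
  have lA : lead_coef A = 1 by apply/monicP.
  have sA : size A = 4%N.
    by have := size_S; rewrite S_bA size_monicM ?monicXsubC ?monic_neq0 // size_XsubC => -[].
  apply: (split2 (c *: A) (f - c *: A)).
  - by rewrite addrC subrK.
  (* The point b + 1 serves only as a point other than b: A vanishes there and f does not. *)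
  - apply: contraNneq (f_root (b + 1)) => /eqP; rewrite subr_eq0 => /eqP ->.
    have b1b : b + 1 != b by rewrite -subr_eq0 addrAC subrr add0r oner_eq0.
    by rewrite hornerZ /A (bigD1 (b + 1)) //= hornerM hornerXsubC subrr mul0r mulr0.
  - apply/leq_sizeP=> j; rewrite leq_eqVlt coefB coefZ => /orP[/eqP <-|j_gt3].
      by rewrite /c /lead_coef in lA *; rewrite sA sf in lA *; rewrite lA mulr1 subrr.
    by rewrite !nth_default ?sf ?sA // mulr0 subrr.
  - rewrite S_bA mulrC dvdp_mul //; first by rewrite dvdpZr.
    by rewrite dvdp_XsubCl rootE !hornerE fb horner_prod_XsubC_neq mulrN1 opprK addNr.
rewrite negb_exists => /forallP f_neqNc.
(* The nonzero values of f lie in a set of two elements. *)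
have /injectivePn[a1 [a2 a12 fa12]] : ~~ injectiveb (fun a => f.[a]).
  apply/negP=> /injectiveP/card_codom; rewrite F4 => card_f.
  have : (#|codom (fun a => f.[a])| <= #|[predC pred2 0%R (- c)]|)%N.
    by apply/subset_leq_card/subsetP=> _ /codomP[a ->]; rewrite !inE negb_or f_root f_neqNc.
  have := cardC (pred2 0 (- c)); rewrite card2 F4 eq_sym oppr_eq0 c_neq0 card_f.
  by move=> /(congr1 (subn^~ 2)); rewrite addKn => ->.
(* With f(a1) = f(a2), a constant multiple of B interpolates f at both points provided B(a1) =
   B(a2); this holds since a1 - a2 = a2 - a1 in characteristic 2. *)
pose B := \prod_(x | (x != a1) && (x != a2)) ('X - x%:P).
have S_aaB : 'X^#|F| - 'X = (('X - a1%:P) * ('X - a2%:P)) * B.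
  by rewrite finField_genPoly (bigD1 a1) //= (bigD1 a2) ?mulrA // eq_sym.
have B_monic : B \is monic by apply: monic_prod_XsubC.
have sB : size B = 3%N.
  have := size_S; rewrite S_aaB -mulrA !size_monicM ?monicXsubC ?monicMl ?monic_neq0 ?monicMl ?monicXsubC //.
  by rewrite !size_XsubC => -[].
have B1 : (a1 - a2) * B.[a1] = -1.
  rewrite -(horner_prod_XsubC_neq a1) (bigD1 a2) /=; last by rewrite eq_sym.
  by rewrite hornerM hornerXsubC.
have B2 : (a2 - a1) * B.[a2] = -1.
  rewrite -(horner_prod_XsubC_neq a2) (bigD1 a1) //= hornerM hornerXsubC.
  by congr (_ * _.[_]); apply: eq_bigl => x; rewrite andbC.
have charF2 : 2%N \in [pchar F] by apply: (@card_finPcharP F 2 2).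
have B12 : B.[a1] = B.[a2].
  have a12_neq0 : a1 - a2 != 0 by rewrite subr_eq0.
  by apply: (mulfI a12_neq0); rewrite B1 -B2 -[a1 - a2](oppr_pchar2 charF2) opprB.
have B1_neq0 : B.[a1] != 0.
  by apply: contra_eq_neq B1 => ->; rewrite mulr0 eq_sym oppr_eq0 oner_eq0.
pose s := f.[a1] / B.[a1].
have s_neq0 : s != 0 by rewrite mulf_neq0 ?invr_eq0 ?f_root.
apply: (split2 (f - s *: B) (s *: B)); rewrite ?subrK //.
- by rewrite scaler_eq0 (negPf s_neq0) -size_poly_gt0 sB.
- by rewrite size_scale ?sB.
rewrite S_aaB dvdp_mul ?dvdpZr // Gauss_dvdp; last first.
  by rewrite coprimep_XsubC2 // subr_eq0 eq_sym.
by rewrite !dvdp_XsubCl !rootE !hornerE -fa12 -B12 /s divfK // subrr eqxx.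
Qed.

(** * Quintics over the field with three elements *)

Lemma size_padd (s t : seq nat) : size (padd s t) = maxn (size s) (size t).
Proof.
elim: s t => [|a s IHs] [|b t] //=; rewrite ?max0n ?maxn0 //.
by rewrite IHs maxnSS.
Qed.

(** The filter in [decomps] bounds the length of a list rather than the degree of its polynomial, so
    membership needs this bound. *)
Lemma size_pmul_leq (s t : seq nat) :
  (0 < size t)%N -> (size (pmul s t) <= (size s + size t).-1)%N.
Proof.
move=> t_gt0; elim: s => // a s IHs; rewrite /= size_padd size_map geq_max leq_addl /=.
by rewrite -(prednK (_ : 0 < size s + size t)%N) ?ltnS // addn_gt0 t_gt0 orbT.
Qed.

Lemma mem_decomps (p d k : nat) (S A B a b : seq nat) :
  k \in iota (size S - d) (2 * d - (size S).-1) ->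
  A \in monic_codes p k -> B \in monic_codes p ((size S).-1 - k) ->
  peq p (pmul A B) S -> a \in deg_codes p (d - k) ->
  b \in codes p (d + k - (size S).-1) -> ~~ peq p (pmul B b) [::] ->
  (size (pmul B b) <= d)%N -> (pmul A a, pmul B b) \in decomps p S d.
Proof.
move=> kS Ak Bk AB ad bd v_neq0 vd; rewrite mem_filter v_neq0 vd /=.
apply/flattenP.
exists [seq (pmul A a, pmul B b) | a <- deg_codes p (d - k), b <- codes p (d + k - (size S).-1)];
  last exact: allpairs_f.
apply/allpairsPdep; exists k, (A, B); split=> //.
by rewrite mem_filter AB; apply: allpairs_f.
Qed.

(** S = X^(q^m) - X has degree 2 d - 1 and divides every product of two distinct terms. Two terms of
    degree below d are too small for this, so only one accompanies the top term; it has degree d -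
    1, and the product is a constant multiple of S. *)
Lemma VID_tight (F : finFieldType) (d m : nat) (g : {poly F}) :
  (0 < m)%N -> (2 * m <= d)%N -> (#|F| ^ m).+1 = (2 * d)%N -> admits_VID d g ->
  exists u v, [/\ g = u + v, size u = d.+1, size v = d &
    u * v = (lead_coef u * lead_coef v) *: ('X^(#|F| ^ m) - 'X)].
Proof.
move=> m_gt0 md qm [r [f [fV ->]]].
set S := 'X^_ - 'X; have sS : size S = (2 * d)%N by rewrite size_XnX ?expn_card_gt1.
have f_neq0 := vid_neq0 fV.
have Sff i j : i != j -> (2 * d < size (f i) + size (f j))%N.
  move=> ij; have := dvdp_leq _ (VID_XqX_dvdM fV ij m_gt0 md).
  rewrite mulf_neq0 // => /(_ isT); rewrite size_mul // -/S sS.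
  by have := f_neq0 i; rewrite -size_poly_gt0; case: (size (f i)).
have [i0 [si0 _]] := vid_top fV; have [j ji0] := VID_other_part i0 fV.
have sf k : k != i0 -> (size (f k) <= d)%N := VID_size_other fV si0.
have two k : k != i0 -> k = j.
  move=> ki0; apply/eqP; apply: contraT => /Sff; rewrite ltnNge mul2n -addnn.
  by rewrite leq_add ?sf.
have sj : size (f j) = d.
  apply/eqP; rewrite eqn_leq sf // -ltnS -(ltn_add2l d).
  by have := Sff i0 j; rewrite eq_sym => /(_ ji0); rewrite si0 mul2n -addnn addSn addnS.
exists (f i0), (f j); split=> //.
  rewrite (bigD1 i0) //= (bigD1 j) //= big_pred0 ?addr0 // => k.
  by apply/negP=> /andP[/two -> /eqP].
have /eqp_eq : f i0 * f j %= S.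
  rewrite eqp_sym -dvdp_size_eqp; last by apply: (VID_XqX_dvdM fV); rewrite // eq_sym.
  by rewrite sS size_mul // si0 sj addSn mul2n addnn.
rewrite lead_coefM => <-; rewrite (_ : lead_coef S = 1) ?scale1r //.
by rewrite lead_coefDl ?lead_coefXn // size_polyN size_polyX size_polyXn ltnS expn_card_gt1.
Qed.

Definition irr_codes35 : seq (seq nat) :=
  let R := reducibles 3 5 in [seq f <- deg_codes 3 5 | ~~ has (peq 3 f) R].

Definition vid_codes35 : seq (seq nat) := [seq padd uv.1 uv.2 | uv <- decomps 3 (XnX 3 9) 5].

Definition distinct35 : rel (seq nat) := fun s t => ~~ peq 3 s t.

(** There are (3^5 - 3)/5 = 48 monic irreducible quintics, and two possible leading coefficients. *)
Lemma irr_codes35_check : (size irr_codes35 == 96) && pairwise distinct35 irr_codes35.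
Proof. by vm_compute. Qed.

(** X^9 - X is a product of three linear and three quadratic irreducibles, so it has 3 * 3 + 3 = 12
    monic factors A of degree 5; each gives four sums a A + b B with nonzero constants a, b. *)
Lemma vid_codes35_check : (size vid_codes35 == 48) && pairwise distinct35 vid_codes35.
Proof. by vm_compute. Qed.

(** As X^9 - X is squarefree, each irreducible of degree at most 2 divides exactly one of A and B,
    hence not a A + b B; a quintic without such factors is irreducible. *)
Lemma vid_irr_codes35_check :
  let I := irr_codes35 in all (fun f => has (peq 3 f) I) vid_codes35.
Proof. by vm_compute. Qed.

Lemma irr_codes35P (F : finFieldType) (g : {poly F}) : #|F| = 3%N ->
  irreducible_of_degree 5 g <-> g \in [seq Pol F f | f <- irr_codes35].
Proof.
move=> F3; split=> [[g_irr sg]|/mapP[f]].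
  have [f fd fg] := deg_codes_surj (isT : prime 3) F3 sg.
  apply/mapP; exists f; last by rewrite fg.
  rewrite mem_filter fd andbT.
  by apply/(reduciblesP (isT : prime 3) F3 (d := 5)) => //; rewrite fg.
rewrite mem_filter => /andP[f_irr fd ->].
have sf := size_Pol_deg_codes (isT : prime 3) F3 fd.
by split=> //; apply/(reduciblesP (isT : prime 3) F3 (d := 5)).
Qed.

Lemma vid_codes35P (F : finFieldType) (g : {poly F}) : #|F| = 3%N ->
  irreducible_of_degree 5 g /\ admits_VID 5 g <-> g \in [seq Pol F f | f <- vid_codes35].
Proof.
move=> F3; have charF3 := pchar_card_prime (isT : prime 3) F3.
have SE : Pol F (XnX 3 9) = 'X^(#|F| ^ 2) - 'X by rewrite Pol_XnX // F3.
split=> [[g_irr gV]|].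
  have [|u [v [gE su sv uvS]]] := VID_tight (d := 5) (m := 2) isT isT _ gV; first by rewrite F3.
  have u_neq0 : u != 0 by rewrite -size_poly_gt0 su.
  have v_neq0 : v != 0 by rewrite -size_poly_gt0 sv.
  have lu_neq0 : lead_coef u != 0 by rewrite lead_coef_eq0.
  have lv_neq0 : lead_coef v != 0 by rewrite lead_coef_eq0.
  (* A and B are u and v divided by their leading coefficients, which become the constants a and b;
     then A B = X^9 - X. *)
  have [||A A5 AE] := monic_codes_surj (g := (lead_coef u)^-1 *: u) (n := 5) (isT : prime 3) F3.
  - by rewrite size_scale ?invr_eq0.
  - by rewrite monicE lead_coefZ mulVf.
  have [||B B4 BE] := monic_codes_surj (g := (lead_coef v)^-1 *: v) (n := 4) (isT : prime 3) F3.
  - by rewrite size_scale ?invr_eq0.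
  - by rewrite monicE lead_coefZ mulVf.
  have [|a a0 aE] := deg_codes_surj (g := (lead_coef u)%:P) (n := 0) (isT : prime 3) F3.
    by rewrite size_polyC lu_neq0.
  have [b b1 bE] := codes_surj [:: lead_coef v] (isT : prime 3) F3.
  have {}bE : Pol F b = (lead_coef v)%:P by rewrite /Pol bE /= cons_poly_def mul0r add0r.
  have uE : Pol F (pmul A a) = u.
    by rewrite Pol_pmul AE aE mulrC mul_polyC scalerA mulfV // scale1r.
  have vE : Pol F (pmul B b) = v.
    by rewrite Pol_pmul BE bE mulrC mul_polyC scalerA mulfV // scale1r.
  apply/mapP; exists (padd (pmul A a) (pmul B b)); last by rewrite Pol_padd uE vE.
  apply/mapP; exists (pmul A a, pmul B b); last by [].
  apply: (mem_decomps (k := 5)) => //.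
  - rewrite (peqP _ _ charF3) Pol_pmul SE AE BE -scalerAl -scalerAr scalerA uvS scalerA.
    by rewrite -invfM mulrC mulfV ?scale1r // mulf_neq0.
  - by rewrite (peqP _ _ charF3) vE.
  - apply: leq_trans (size_pmul_leq _ _) _; rewrite ?(size_codes b1) //.
    by case/allpairsP: B4 => [[c s] [_ /size_codes sE ->]]; rewrite size_rcons sE.
move=> gD; have g_irr : irreducible_of_degree 5 g.
  apply/(irr_codes35P _ F3); have /mapP[f fD ->] := gD.
  have /allP/(_ f fD)/hasP[h hI] := vid_irr_codes35_check.
  by rewrite (peqP _ _ charF3) => /eqP->; apply: map_f.
split=> //; have /mapP[_ /mapP[uv uvD ->] gE] := gD.
rewrite gE Pol_padd; have [uvS v_neq0 vd] := decompsP (isT : prime 3) F3 uvD.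
apply: (admits_VID2 _ _ v_neq0 vd); [by []|by rewrite -Pol_padd -gE|].
move=> h h_irr hd; apply: dvdp_trans uvS; rewrite SE.
exact: (small_dvdp_XqX h_irr hd).
Qed.

Lemma uniq_Pol35 (F : finFieldType) (s : seq (seq nat)) : #|F| = 3%N ->
  pairwise distinct35 s -> uniq [seq Pol F f | f <- s].
Proof.
move=> F3 s_dist; rewrite uniq_pairwise pairwise_map.
apply: sub_pairwise s_dist => f g.
by rewrite /distinct35 (peqP _ _ (pchar_card_prime (isT : prime 3) F3)).
Qed.

(** * Classification of the pairs (q, d) *)

Theorem theorem1 (q d : nat) (F : finFieldType) (hq : #|F| = q)
    (hd : (2 <= d)%N) :
  [/\ (q, d) \in all_VID_pairs ->
        forall g : {poly F}, irreducible_of_degree d g -> admits_VID d g,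
      (q, d) = (3, 5)%N ->
        exists n : nat,
          has_card (fun g : {poly F} => irreducible_of_degree d g) (2 * n)%N /\
          has_card (fun g : {poly F} =>
                      irreducible_of_degree d g /\ admits_VID d g) n
    & (q, d) \notin all_VID_pairs -> (q, d) <> (3, 5)%N ->
        forall g : {poly F}, irreducible_of_degree d g -> ~ admits_VID d g].
Proof.
split; last by move=> qd qd35 g _; apply: not_admits_VID; rewrite ?hq.
  rewrite -hq !inE => qd g; move: qd.
  (* The parameter m is a common multiple of 1, ..., d/2: m = 1 for d = 2, 3 and m = 2 for d = 4, 5.
     For d = 6, 7 this would need X^64 - X, so a smaller multiple of the irreducibles is used. *)
  case/orP=> [/eqP[qE ->]|].
    by apply: (check_XqX_admits_VID (m := 1)); rewrite ?qE; vm_compute.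
  case/orP=> [/eqP[qE ->]|].
    by apply: (check_XqX_admits_VID (m := 1)); rewrite ?qE; vm_compute.
  case/orP=> [/eqP[qE ->]|].
    by apply: (check_XqX_admits_VID (m := 1)); rewrite ?qE; vm_compute.
  case/orP=> [/eqP[qE ->]|].
    by apply: (check_XqX_admits_VID (m := 1)); rewrite ?qE; vm_compute.
  case/orP=> [/eqP[qE ->]|]; first exact: admits_VID_F4.
  case/orP=> [/eqP[qE ->]|].
    by apply: (check_XqX_admits_VID (m := 1)); rewrite ?qE; vm_compute.
  case/orP=> [/eqP[qE ->]|].
    by apply: (check_XqX_admits_VID (m := 2)); rewrite ?qE; vm_compute.
  case/orP=> [/eqP[qE ->]|].
    by apply: (check_XqX_admits_VID (m := 2)); rewrite ?qE; vm_compute.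
  case/orP=> [/eqP[qE ->]|]; first by apply: (check_F2_admits_VID qE); vm_compute.
  by case/eqP=> qE ->; apply: (check_F2_admits_VID qE); vm_compute.
case=> q3 ->; rewrite q3 in hq; exists 48%N; split.
  have /andP[/eqP s96 dist] := irr_codes35_check.
  exists [seq Pol F f | f <- irr_codes35]; split; last by rewrite size_map.
    exact: uniq_Pol35.
  by move=> g; apply: iff_sym; apply: irr_codes35P.
have /andP[/eqP s48 dist] := vid_codes35_check.
exists [seq Pol F f | f <- vid_codes35]; split; last by rewrite size_map.
  exact: uniq_Pol35.
by move=> g; apply: iff_sym; apply: vid_codes35P.
Qed.
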